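(* No connected graph $G$ of order greater than one has a unique minimum zero forcing set.
   Context: A graph $G=(V_G,E_G)$ is a finite simple undirected graph with nonempty vertex set; its order is $|V_G|$. Given a coloring of the vertices black or white, the color change rule is: change the color of a white vertex $w$ to black if $w$ is the unique white neighbor of some black vertex $u$ (then $u$ forces $w$, written $u\to w$). The derived set of an initial set of black vertices is the set of black vertices obtained by applying the rule until no more changes are possible. A zero forcing set is a set $Z\subseteq V_G$ such that, if initially exactly the vertices of $Z$ are black, the derived set is $V_G$. The zero forcing number $\mathrm{Z}(G)$ is the minimum of $|Z|$ over all zero forcing sets $Z$. A minimum zero forcing set is a zero forcing set $Z$ with $|Z|=\mathrm{Z}(G)$. *)

(* Defs.v *)
From mathcomp Require Import all_boot.

Set Implicit Arguments.
Unset Strict Implicit.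
Unset Printing Implicit Defensive.

Record sgraph := SGraph {
  vertex :> finType;
  adj : rel vertex;
  adj_sym : symmetric adj;
  adj_irrefl : irreflexive adj;
  vertex_nonempty : 0 < #|vertex| }.

Section ZeroForcing.
Variable G : sgraph.
Implicit Types (B D Z : {set G}) (u w : G).

Definition connected := [forall x : G, forall y : G, connect (@adj G) x y].

(* A coloring is represented by its set of black vertices. *)
Definition white_neighbors B u : {set G} := [set v | adj u v & v \notin B].

Definition forces B u w := (u \in B) && (white_neighbors B u == [set w]).

Definition color_change B B' :=
  [exists u, exists w, forces B u w && (B' == w |: B)].

Definition stalled B := ~~ [exists B', color_change B B'].

(* [derived Z D]: some sequence of single color changes leads from [Z] to [D],
   where the rule no longer applies; see [derived_exists], [derived_unique]. *)
Definition derived Z D := connect color_change Z D && stalled D.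

Definition zero_forcing Z := derived Z [set: G].

(* The seed [setT] is legitimate by [zero_forcingT]. *)
Definition zero_forcing_number :=
  #|[arg min_(Z < [set: G] | zero_forcing Z) #|Z|]|.

Definition min_zero_forcing Z :=
  zero_forcing Z && (#|Z| == zero_forcing_number).

Lemma forces_white B u w : forces B u w -> adj u w /\ w \notin B.
Proof.
case/andP=> _ /eqP/setP/(_ w); rewrite !inE eqxx => /andP[]; by split.
Qed.

Lemma derived_exists Z : exists D, derived Z D.
Proof.
have [n] := ubnP #|~: Z|; elim: n Z => // n IHn Z ltZn.
have [st|] := boolP (stalled Z); first by exists Z; rewrite /derived connect0.
rewrite negbK => /existsP[Z' cZ]; have [|D /andP[cD sD]] := IHn Z'.
  case/existsP: (cZ) => u /existsP[w /andP[/forces_white[_ wZ] /eqP->]].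
  move: ltZn; rewrite ltnS; apply: leq_trans; apply: proper_card.
  rewrite properE setCS subsetUr /=; apply/subsetPn.
  by exists w; rewrite !inE ?eqxx.
by exists D; rewrite /derived (connect_trans (connect1 cZ)).
Qed.

Lemma reachable_sub_derived Z B D :
  connect color_change Z B -> derived Z D -> B \subset D.
Proof.
move=> cB /andP[cD sD].
have grow A A' : connect color_change A A' -> A \subset A'.
  case/connectP=> p; elim: p A => [|C p IHp] A /=; first by move=> _ ->.
  case/andP=> /existsP[u /existsP[w /andP[_ /eqP defC]]] pC defA.
  by apply: subset_trans (IHp _ pC defA); rewrite defC subsetUr.
have: Z \subset D by apply: grow.
case/connectP: cB => p; elim: p Z {cD} => [|C p IHp] A /=; first by move=> _ ->.
case/andP=> /existsP[u /existsP[w /andP[fuw /eqP ->]]] pC defB sAD.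
apply: (IHp _ pC defB); rewrite subUset sAD sub1set andbT.
apply: contraR sD => wD; apply/existsP; exists (w |: D).
apply/existsP; exists u; apply/existsP; exists w; rewrite eqxx andbT.
have [uw _] := forces_white fuw; case/andP: fuw => uA /eqP defW.
rewrite /forces (subsetP sAD) //= eqEsubset sub1set inE uw wD !andbT -defW.
apply/subsetP=> v; rewrite !inE => /andP[-> vD] /=.
by apply: contra vD; apply: subsetP.
Qed.

Lemma derived_unique Z D D' : derived Z D -> derived Z D' -> D = D'.
Proof.
move=> dD dD'; case/andP: (dD) (dD') => cD _ /andP[cD' _].
by apply/eqP; rewrite eqEsubset !(@reachable_sub_derived Z).
Qed.

Lemma zero_forcingT : zero_forcing [set: G].
Proof.
rewrite /zero_forcing /derived connect0 /=.
apply/existsP=> -[B /existsP[u /existsP[w /andP[/forces_white[_]]]]].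
by rewrite inE.
Qed.

Lemma zero_forcing_number_min Z : zero_forcing Z -> zero_forcing_number <= #|Z|.
Proof.
rewrite /zero_forcing_number; case: arg_minnP; first exact: zero_forcingT.
by move=> A _; apply.
Qed.

Lemma min_zero_forcing_exists : exists Z, min_zero_forcing Z.
Proof.
rewrite /min_zero_forcing /zero_forcing_number.
case: arg_minnP; first exact: zero_forcingT.
by move=> A fA _; exists A; rewrite fA eqxx.
Qed.

End ZeroForcing.

Arguments connected : clear implicits.
Arguments zero_forcing_number : clear implicits.

(* Main.v *)
(** Reverse the forces. If [u_1 -> w_1, ..., u_k -> w_k] is a complete run of
    forces from [Z], then the [u_i] are distinct and
    [w_k -> u_k, ..., w_1 -> u_1] is a complete run from the complement [W] of
    [{u_1, ..., u_k}], so that [W] is a zero forcing set with [#|W| = #|Z|].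
    If [Z] is not the whole vertex set, then [u_1] lies in [Z] but not in [W].
    An edge [u v] shows that the whole vertex set is not minimum, since its
    other vertices force [v]. *)
Require Import Defs.
From mathcomp Require Import all_boot.

Definition saturated {G : sgraph} (A S : {set G}) :=
  S \subset A /\ forall x y, x \in S -> adj x y -> y \in A.

Lemma forces_color_change {G : sgraph} {B : {set G}} {u w : G} :
  forces B u w -> color_change B (w |: B).
Proof.
by move=> fuw; apply/existsP; exists u; apply/existsP; exists w; rewrite fuw /=.
Qed.

(** As long as [w] is white, [u] has a white neighbor; once [w] is black, it has none left. *)
Lemma forces_saturated {G : sgraph} {A S : {set G}} {u w : G} :
  forces A u w -> saturated A S -> u \notin S /\ saturated (w |: A) (u |: S).
Proof.
move=> fuw [SA satS]; have [uw wA] := forces_white fuw.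
case/andP: fuw => uA /eqP defN.
split; first by apply: contra wA => uS; exact: satS uw.
split=> [|x y].
  apply/subsetP=> x /setU1P[-> | xS]; rewrite !inE ?uA ?orbT //.
  by rewrite (subsetP SA) ?orbT.
case/setU1P=> [-> uy | xS xy]; last by rewrite !inE (satS x y) ?orbT.
rewrite !inE; case yA: (y \in A); rewrite ?orbT // orbF.
by rewrite -in_set1 -defN inE uy yA.
Qed.

(** A neighbor of [w] in [S] would put [w] in [A], so [u] is the only neighbor of [w] in
    [u |: S]. *)
Lemma forces_reversed {G : sgraph} {A S : {set G}} {u w : G} :
  forces A u w -> saturated A S -> forces (~: (u |: S)) w u.
Proof.
move=> fuw satAS; have [SA satS] := satAS; have [uw wA] := forces_white fuw.
case/andP: fuw => uA _; apply/andP; split.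
  rewrite !inE negb_or; apply/andP; split.
    by apply: contraNneq wA => ->.
  by apply: contra wA; apply: subsetP.
apply/eqP/setP=> x; rewrite !inE negbK.
have [-> | _] /= := eqVneq x u; first by rewrite adj_sym uw.
apply: contraNF wA => /andP[wx xS].
by apply: (satS x) => //; rewrite adj_sym.
Qed.

(* The first force [u -> w] is undone last, when [u] has to stay white during
   the whole reversed run from [W]. The induction on the run therefore allows
   any set [S] of vertices that force nothing in the run to be kept white. *)
Lemma reversal_exists {G : sgraph} {A : {set G}} :
  connect (@color_change G) A [set: G] ->
  exists W : {set G},
    [/\ #|W| = #|A|, W = A -> A = [set: G] &
        forall S, saturated A S ->
          S \subset W /\ connect (@color_change G) (W :\: S) (~: S)].
Proof.
case/connectP=> p; elim: p A => [|A' p IHp] A /=.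
  move=> _ <-; exists [set: G]; split=> // S _.
  by rewrite subsetT setTD connect0.
case/andP=> /existsP[u /existsP[w /andP[fuw /eqP->]]] pA lastA.
have [W [cardW _ satW]] := IHp _ pA lastA.
have [_ wA] := forces_white fuw; have uA : u \in A by case/andP: fuw.
exists (W :\ u); split=> [|eqWA|S satS].
(* The case of empty [S] shows that [u] lies in [W], so deleting [u] offsets the vertex [w] added to
   [A]. *)
- have sat0 : saturated A set0 by split=> [|x y]; rewrite ?sub0set ?inE.
  have [_ /satW[sW _]] := forces_saturated fuw sat0.
  have uW : u \in W by rewrite (subsetP sW) ?setU11.
  by have := cardsU1 w A; rewrite wA -cardW (cardsD1 u W) uW => /addnI.
- by move: uA; rewrite -eqWA setD11.
have [uS /satW[sW cW]] := forces_saturated fuw satS.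
split.
  apply/subsetP=> x xS; rewrite !inE (subsetP sW) ?inE ?xS ?orbT // andbT.
  by apply: contraNneq uS => <-.
(* Reverse the later forces with [u |: S] kept white, then add [w -> u]. *)
rewrite setDDl; apply: connect_trans cW (connect1 _).
have -> : ~: S = u |: ~: (u |: S).
  by apply/setP=> x; rewrite !inE; case: eqVneq => [->|].
exact/forces_color_change/(forces_reversed fuw satS).
Qed.

Lemma zero_forcing_connect {G : sgraph} (Z : {set G}) :
  zero_forcing Z = connect (@color_change G) Z [set: G].
Proof.
by rewrite /zero_forcing /derived; case/andP: (zero_forcingT G) => _ ->; rewrite andbT.
Qed.

Lemma connected_edge {G : sgraph} :
  connected G -> 1 < #|G| -> exists u v : G, adj u v.
Proof.
move=> /forallP connG /card_gt1P[x [y [_ _ neq_xy]]].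
have /forallP/(_ y)/connectP[[|z p] /=] := connG x.
  by move=> _ eq_yx; rewrite eq_yx eqxx in neq_xy.
by case/andP=> xz _ _; exists x, z.
Qed.

Lemma zero_forcing_setD1 {G : sgraph} {u v : G} :
  adj u v -> zero_forcing ([set: G] :\ v).
Proof.
move=> uv; rewrite zero_forcing_connect -[X in connect _ _ X](setD1K (in_setT v)).
apply/connect1/forces_color_change/(_ : forces _ u v)/andP; split.
  by rewrite !inE andbT; apply: contraTneq uv => ->; rewrite adj_irrefl.
apply/eqP/setP=> x; rewrite !inE andbT negbK.
by case: eqVneq => [->|]; rewrite ?uv ?andbF.
Qed.

Theorem corollary2p7 (G : sgraph) (connG : connected G) (ordG : 1 < #|G|) :
  ~ (exists! Z : {set G}, min_zero_forcing Z).
Proof.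
case=> Z [/andP[zfZ /eqP cardZ] uniqZ].
have [W [cardW eqWZ satW]] : exists W : {set G}, _ :=
  reversal_exists (etrans (esym (zero_forcing_connect Z)) zfZ).
(* With nothing kept white, the reversed run from [W] reaches every vertex. *)
have sat0 : saturated Z set0 by split=> [|x y]; rewrite ?sub0set ?inE.
have [_] := satW _ sat0; rewrite setD0 setC0 -zero_forcing_connect => zfW.
have defZ : Z = [set: G].
  by apply/eqWZ/esym/uniqZ; rewrite /min_zero_forcing zfW cardW cardZ /=.
have [u [v /zero_forcing_setD1/zero_forcing_number_min]] := connected_edge connG ordG.
by rewrite -cardZ defZ (cardsD1 v [set: G]) inE ltnn.
Qed.
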